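(* Let $p$ be a prime number, $n\geq 1$ an integer and $N=p^{n}$. Let $k\in\mathbb{Z}$, and write $\overline{k}=k+N\mathbb{Z}$. (i) Suppose $p\neq 2$. The $\overline{k}$-monomial minimal solution of $(E_{N})$ is irreducible if and only if $p$ does not divide $k$. In particular, $(E_{N})$ has exactly $\varphi(p^{n})=p^{n-1}(p-1)$ irreducible monomial minimal solutions. (ii) Suppose $p=2$. The $\overline{k}$-monomial minimal solution of $(E_{N})$ is irreducible if and only if at least one of the following properties holds: - $k$ is odd; - $\overline{k}=\overline{2^{n-1}}$; - $n\geq 2$ and there exists an odd integer $a$ such that $k=2a$. In particular, if $n\geq 3$, $(E_{N})$ has exactly $3\times 2^{n-2}+1$ irreducible monomial minimal solutions.
   Context: Let $N\geq 2$ be an integer and write $\overline{a}=a+N\mathbb{Z}$ for $a\in\mathbb{Z}$. For $\overline{a_1},\ldots,\overline{a_s}\in\mathbb{Z}/N\mathbb{Z}$ put $$M_s(\overline{a_1},\ldots,\overline{a_s})=\begin{pmatrix}\overline{a_s}&-\overline{1}\\ \overline{1}&\overline{0}\end{pmatrix}\begin{pmatrix}\overline{a_{s-1}}&-\overline{1}\\ \overline{1}&\overline{0}\end{pmatrix}\cdots\begin{pmatrix}\overline{a_1}&-\overline{1}\\ \overline{1}&\overline{0}\end{pmatrix}.$$ A solution of $(E_N)$ of size $s$ ($s\geq 1$) is an $s$-tuple $(\overline{a_1},\ldots,\overline{a_s})\in(\mathbb{Z}/N\mathbb{Z})^s$ with $M_s(\overline{a_1},\ldots,\overline{a_s})=\pm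 \mathrm{Id}$ over $\mathbb{Z}/N\mathbb{Z}$. Monomial minimal solutions: for $\overline{k}\in\mathbb{Z}/N\mathbb{Z}$, the $\overline{k}$-monomial minimal solution of $(E_N)$ is the tuple $(\overline{k},\ldots,\overline{k})$ of size $s$, where $s\geq 1$ is the smallest integer such that the $s$-tuple with all entries equal to $\overline{k}$ is a solution of $(E_N)$ (it exists and is unique). A monomial minimal solution is a $\overline{k}$-monomial minimal solution for some $\overline{k}\in\mathbb{Z}/N\mathbb{Z}$. Sum of tuples: $(\overline{a_1},\ldots,\overline{a_m})\oplus(\overline{b_1},\ldots,\overline{b_l})=(\overline{a_1+b_l},\overline{a_2},\ldots,\overline{a_{m-1}},\overline{a_m+b_1},\overline{b_2},\ldots,\overline{b_{l-1}})$, an $(m+l-2)$-tuple. Equivalence: $(\overline{a_1},\ldots,\overline{a_s})\sim(\overline{b_1},\ldots,\overline{b_s})$ if $(\overline{b_1},\ldots,\overline{b_s})$ is obtained by a cyclic permutation of $(\overline{a_1},\ldots,\overline{a_s})$ or of $(\overline{a_s},\ldots,\overline{a_1})$. Irreducibility: a solution $(\overline{c_1},\ldots,\overline{c_s})$ of $(E_N)$ with $s\geq 3$ is reducible if there exist a solution $(\overline{b_1},\ldots,\overline{b_l})$ of $(E_N)$ and an $m$-tuple $(\overline{a_1},\ldots,\overline{a_m})$ of elements of $\mathbb{Z}/N\mathbb{Z}$ with $m\geq 3$, $l\geq 3$ and $(\overline{c_1},\ldots,\overline{c_s})\sim(\overline{a_1},\ldots,\overline{a_m})\oplus(\overline{b_1},\ldots,\overline{b_l})$.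 A solution is irreducible if it is not reducible; by convention $(\overline{0},\overline{0})$ (the only solution of size 2) is not considered irreducible. There is no solution of size 1. $\varphi$ is Euler's totient function. *)

(* Defs.v *)
From HB Require Import structures.
From mathcomp Require Import all_boot all_order all_algebra all_fingroup.

Set Implicit Arguments.
Unset Strict Implicit.
Unset Printing Implicit Defensive.

Import GRing.Theory.
Local Open Scope ring_scope.

(* Everything is stated over 'Z_N, which is Z/NZ only when N >= 2.  Tuples of  *)
(* variable size are sequences.                                               *)

Definition elemM (N : nat) (a : 'Z_N) : 'M['Z_N]_2 :=
  \matrix_(i, j) nth 0 (nth [::] [:: [:: a; -1]; [:: 1; 0]] i) j.

(* The matrix of the last entry is the leftmost factor, hence the reversal.   *)
Definition Mprod (N : nat) (c : seq 'Z_N) : 'M['Z_N]_2 :=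
  \prod_(a <- rev c) elemM a.

Definition solution (N : nat) (c : seq 'Z_N) : bool :=
  (0 < size c)%N && ((Mprod c == 1) || (Mprod c == -1)).

(* belast x s is x :: s without its last entry.  Sequences with fewer than    *)
(* two entries get a junk value.                                              *)
Definition oplus (N : nat) (a b : seq 'Z_N) : seq 'Z_N :=
  match a, b with
  | a1 :: a2 :: a', b1 :: b2 :: b' =>
      (a1 + last b2 b') :: belast a2 a' ++ (last a2 a' + b1) :: belast b2 b'
  | _, _ => [::]
  end.

Definition tuple_equiv (N : nat) (a b : seq 'Z_N) : Prop :=
  exists i : nat, b = rot i a \/ b = rot i (rev a).

Definition reducible (N : nat) (c : seq 'Z_N) : Prop :=
  [/\ solution c, (3 <= size c)%N &
      exists a b : seq 'Z_N,
        [/\ (3 <= size a)%N, (3 <= size b)%N, solution b &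
            tuple_equiv c (oplus a b)]].

(* (0, 0) is not reducible, but is by convention not irreducible either.     *)
Definition irreducible_solution (N : nat) (c : seq 'Z_N) : Prop :=
  [/\ solution c, c <> [:: 0; 0] & ~ reducible c].

Lemma det_elemM (N : nat) (a : 'Z_N) : \det (elemM a) = 1.
Proof.
rewrite (expand_det_row _ ord0) !big_ord_recl big_ord0 /cofactor !det_mx11.
by rewrite !mxE /= mulr0 mulr0 add0r addr0 expr1 mulr1 mulrNN mulr1.
Qed.

Lemma Mprod_nseq (N : nat) (k : 'Z_N) (s : nat) :
  Mprod (nseq s k) = elemM k ^+ s.
Proof.
by rewrite /Mprod rev_nseq big_nseq -Monoid.iteropE.
Qed.

Lemma ex_monomial_solution (N : nat) (k : 'Z_N) :
  exists s : nat, solution (nseq s k).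
Proof.
have Uk : elemM k \is a GRing.unit by rewrite unitmxE det_elemM unitr1.
exists #[FinRing.Unit Uk]%g.
rewrite /solution size_nseq order_gt0 Mprod_nseq.
by rewrite -(FinRing.val_unitX _ (FinRing.Unit Uk)) expg_order /= eqxx.
Qed.

Definition monomial_size (N : nat) (k : 'Z_N) : nat :=
  ex_minn (ex_monomial_solution k).

Definition monomial_minimal_solution (N : nat) (k : 'Z_N) : seq 'Z_N :=
  nseq (monomial_size k) k.

Definition is_monomial_minimal (N : nat) (c : seq 'Z_N) : Prop :=
  exists k : 'Z_N, c = monomial_minimal_solution k.

Definition has_exactly (T : eqType) (m : nat) (P : T -> Prop) : Prop :=
  exists s : seq T, [/\ uniq s, forall x, x \in s <-> P x & size s = m].

(* Main.v *)
(* Write E for the elementary matrix of k, and U_j for the Chebyshev-like     *)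
(* sequence U_0 = 0, U_1 = 1, U_(j+2) = k U_(j+1) - U_j, so that the entries  *)
(* of E^j are U_(j+1), -U_j, U_j, -U_(j-1).  The tuple x, k, ..., k, y with  *)
(* j copies of k is a solution for suitable x, y iff U_(j+1) = 1 or -1; hence *)
(* the k-monomial minimal solution is reducible iff U_(j+1) = 1 or -1 for     *)
(* some j such that neither E^j nor E^(j+2) is 1 or -1.                       *)
(* - k a unit: U_j U_(j+2) = U_(j+1)^2 - 1 = 0 while U_j + U_(j+2) is a unit, *)
(*   so U_j = 0 or U_(j+2) = 0 and E^j or E^(j+2) is 1 or -1.                 *)
(* - p = 2 and k = 2a with a odd: j = 2m is even, and with the units          *)
(*   T_m = U_(m+1) - a U_m one has U_(2m+1) - 1 = 2 U_m T_(m+1),              *)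
(*   U_(2m+1) + 1 = 2 U_(m+1) T_m and U_(2m) = 2 U_m T_m.                     *)
(* - p | k and 2k <> 0 (and 4 | k if p = 2): let d = p^t k be the last        *)
(*   nonzero multiple of k of this form.  Since E^2 = -(1 - kE), iterating    *)
(*   p-th powers gives E^(2 p^t) = 1 - d E up to sign, so j = 2 p^t works.    *)
(* - If p = 2, 4 | k and 2k = 0, then k = 0 or k = 2^(n-1), and E^4 = 1 in    *)
(*   the latter case.                                                         *)

Require Import Defs.
From HB Require Import structures.
From mathcomp Require Import all_boot all_order all_algebra all_fingroup.
From mathcomp Require Import ring zify.

Set Implicit Arguments.
Unset Strict Implicit.

Import GRing.Theory.
Local Open Scope ring_scope.

(** A reduction of a constant solution splits off a summand that is constant between its two ends,
    so [reducible_monomialP] turns irreducibility into the question of which U_j are signs, that is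
    1 or -1. The ring Z/p^n is local. For a unit k, U_j U_(j+2) = 0 forces one factor to vanish
    ([irreducible_unit]). For k in the maximal ideal, taking p-th powers yields a power of E equal
    to a sign times 1 - dE with d nonzero and pd = 0, hence a reduction ([not_irreducible_mulp]).
    This argument leaves out 2k = 0 and, for p = 2, k = 2a with a odd; [not_irreducible_0],
    [irreducible_half_modulus] and [irreducible_double_unit] settle these classes. The counts are
    counts of residues, by [monomial_minimal_solution_inj]. *)

Definition pm1 (A : pzRingType) (x : A) : bool := (x == 1) || (x == -1).

Lemma pm1P (A : pzRingType) (x : A) : reflect (x = 1 \/ x = -1) (pm1 x).
Proof. by apply: (iffP orP) => -[/eqP|/eqP]; auto. Qed.

Lemma pm1N (A : pzRingType) (x : A) : pm1 (- x) = pm1 x.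
Proof. by rewrite /pm1 eqr_opp eqr_oppLR orbC. Qed.

Lemma pm1_mull (A : pzRingType) (x y : A) : pm1 x -> pm1 (x * y) = pm1 y.
Proof. by case/pm1P=> ->; rewrite ?mul1r // mulN1r pm1N. Qed.

Lemma pm1_sqr (A : pzRingType) (x : A) : pm1 x -> x * x = 1.
Proof. by case/pm1P=> ->; rewrite ?mul1r // mulrNN mul1r. Qed.

Lemma pm1X (A : pzRingType) (x : A) n : pm1 x -> pm1 (x ^+ n).
Proof.
move=> x1; elim: n => [|n IH]; first by rewrite expr0 /pm1 eqxx.
by rewrite exprS pm1_mull.
Qed.

Lemma pm1_unit (A : unitRingType) (x : A) : pm1 x -> x \is a GRing.unit.
Proof. by case/pm1P=> ->; rewrite ?unitrN unitr1. Qed.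

(* [chebU k n.+1] is the continuant K_n(k, ..., k), i.e. U_n(k / 2) for the   *)
(* Chebyshev polynomial of the second kind; the shift makes [chebU k 0 = 0].  *)
Fixpoint chebU (R : pzRingType) (k : R) (n : nat) : R :=
  if n is n1.+1 then
    if n1 is n2.+1 then k * chebU k n1 - chebU k n2 else 1
  else 0.

(** * Identities of the Chebyshev-like sequence *)

Section ChebyshevIdentities.
Variables (R : comPzRingType) (k : R).

Lemma chebUSS n : chebU k n.+2 = k * chebU k n.+1 - chebU k n.
Proof. by []. Qed.

(** The left side is the determinant of E^n. *)
Lemma chebU_det n :
  chebU k n.+1 ^+ 2 - k * chebU k n.+1 * chebU k n + chebU k n ^+ 2 = 1.
Proof.
elim: n => [|n IH]; first by rewrite /=; ring.
by rewrite chebUSS -[RHS]IH; ring.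
Qed.

Lemma chebU_cassini n :
  chebU k n.+1 ^+ 2 - chebU k n * chebU k n.+2 = 1.
Proof. by rewrite -[RHS](chebU_det n) chebUSS; ring. Qed.

Lemma chebU_double n :
  chebU k n.*2 = chebU k n * (2 * chebU k n.+1 - k * chebU k n) /\
  chebU k n.*2.+1 = chebU k n.+1 ^+ 2 - chebU k n ^+ 2.
Proof.
elim: n => [|n [IH0 IH1]]; first by split=> /=; ring.
rewrite doubleS; set m := n.*2 in IH0 IH1 *.
have E0 : chebU k m.+2 = chebU k n.+1 * (2 * chebU k n.+2 - k * chebU k n.+1).
  by rewrite chebUSS IH0 IH1 (chebUSS n); ring.
split; first exact: E0.
rewrite (chebUSS m.+1) E0 IH1 (chebUSS n); ring.
Qed.

Lemma chebU_even n :
  chebU k n.*2 = chebU k n * (2 * chebU k n.+1 - k * chebU k n).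
Proof. by case: (chebU_double n). Qed.

Lemma chebU_oddB1 n :
  chebU k n.*2.+1 - 1 = chebU k n * (2 * chebU k n.+2 - k * chebU k n.+1).
Proof.
by case: (chebU_double n) => _ ->; rewrite -{1}(chebU_det n) chebUSS; ring.
Qed.

Lemma chebU_oddD1 n :
  chebU k n.*2.+1 + 1 = chebU k n.+1 * (2 * chebU k n.+1 - k * chebU k n).
Proof. by case: (chebU_double n) => _ ->; rewrite -{1}(chebU_det n); ring. Qed.

End ChebyshevIdentities.

(** * Powers of the elementary matrix *)

Section PowersOfElementary.
Variables (N : nat) (k : 'Z_N).
Implicit Types (x y : 'Z_N) (j : nat).

(** By Cayley-Hamilton, E^2 = kE - 1, so every power of E is a combination of E and 1. *)
Lemma elemM_expE j :
  elemM k ^+ j = chebU k j *: elemM k + (chebU k j.+1 - k * chebU k j)%:M.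
Proof.
elim: j => [|j IH].
  by rewrite expr0 /= scale0r add0r mulr0 subr0.
rewrite exprS IH mulrDr -scalerAr.
have -> : elemM k * elemM k = k *: elemM k - 1.
  apply/matrixP=> a b; rewrite mxE !big_ord_recl big_ord0 !mxE.
  case: a b => [[|[|]]] // ? [[|[|]]] //= ?; rewrite ?mxE /=; ring.
rewrite -[(_ - _)%:M]scalemx1 -[X in _ = _ + X]scalemx1 -scalerAr mulr1.
apply/matrixP=> a b; rewrite !mxE chebUSS; ring.
Qed.

Lemma elemM_exp00 j : (elemM k ^+ j) 0 0 = chebU k j.+1.
Proof. by rewrite elemM_expE !mxE /=; ring. Qed.
Lemma elemM_exp10 j : (elemM k ^+ j) 1 0 = chebU k j.
Proof. by rewrite elemM_expE !mxE /=; ring. Qed.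

Lemma pm1_elemM_exp j :
  pm1 (elemM k ^+ j) = (chebU k j == 0) && pm1 (chebU k j.+1).
Proof.
apply/idP/andP=> [|[/eqP U0 /pm1P U1]].
  rewrite -elemM_exp10 -elemM_exp00.
  by case/pm1P=> ->; split; rewrite !mxE /= ?oppr0 /pm1 ?eqxx ?orbT.
rewrite elemM_expE U0 scale0r add0r mulr0 subr0.
apply/pm1P; case: U1 => ->; [by left | right].
by rewrite raddfN.
Qed.

(** With P = U_(j+1) and Q = U_j, the lower right entry is -P and the off-diagonal entries are Px -
    Q and Q - yP. Once P is a sign these determine x and y, and [chebU_det] gives the last entry. *)
Lemma pm1_elemM_sandwich x y j :
  pm1 (elemM y * elemM k ^+ j * elemM x) =
  [&& pm1 (chebU k j.+1), x == chebU k j.+1 * chebU k j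
    & y == chebU k j.+1 * chebU k j].
Proof.
set P := chebU k j.+1; set Q := chebU k j.
pose B := elemM y * elemM k ^+ j * elemM x.
have BE (a b : 'I_2) : B a b =
    if a == 0 then if b == 0 then y * (P * x - Q) - Q * x - (P - k * Q)
                   else Q - y * P
    else if b == 0 then P * x - Q else - P.
  rewrite /B elemM_expE -/P -/Q mxE !big_ord_recl big_ord0 !mxE.
  rewrite !big_ord_recl !big_ord0 !mxE.
  by case: a b => [[|[|]]] // ? [[|[|]]] //= ?; rewrite ?mxE /=; ring.
have detE := chebU_det k j; rewrite -/P -/Q in detE.
apply/idP/idP=> [BP | /and3P[P1 /eqP xE /eqP yE]].
  have [B01 B10 P1] : [/\ B 0 1 = 0, B 1 0 = 0 & pm1 P].
    have -> : P = - B 1 1 by rewrite BE opprK.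
    case/pm1P: BP; rewrite -/B => ->; rewrite !mxE /= ?oppr0 ?opprK;
      by rewrite /pm1 ?eqxx ?orbT.
  have PP := pm1_sqr P1.
  rewrite BE /= in B01; rewrite BE /= in B10.
  rewrite P1 -{1}(subr0_eq B10) (subr0_eq B01) mulrA PP mul1r mulrCA PP mulr1.
  by rewrite !eqxx.
rewrite -pm1N; suff -> : - (elemM y * elemM k ^+ j * elemM x) = P%:M.
  by case/pm1P: P1 => ->; rewrite ?raddfN /pm1 eqxx ?orbT.
have PP := pm1_sqr P1.
have PQ : P * (P * Q) = Q by rewrite mulrA PP mul1r.
have QQ : Q ^+ 2 = k * P * Q.
  by apply/eqP; rewrite -subr_eq0 -(subrr 1) -{1}detE -{1}PP; apply/eqP; ring.
apply/matrixP=> a b; rewrite mxE -/B BE mxE xE yE.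
case: a b => [[|[|]]] // ? [[|[|]]] //= ?.
- have -> : Q * (P * Q) = k * Q.
    by rewrite -[in RHS]PQ mulrCA -expr2 QQ; ring.
  by rewrite PQ subrr; ring.
- by rewrite [P * Q * P]mulrC PQ subrr oppr0.
- by rewrite PQ subrr oppr0.
- by rewrite opprK.
Qed.

End PowersOfElementary.

(** * Reducibility of constant solutions *)

Section MonomialSolutions.
Variables (N : nat) (k : 'Z_N).
Implicit Types (c : seq 'Z_N) (s j : nat).

Lemma solution_nseq s :
  solution (nseq s k) = (0 < s)%N && pm1 (elemM k ^+ s).
Proof. by rewrite /solution size_nseq Mprod_nseq. Qed.

Lemma solution_sandwich x y j :
  solution (x :: rcons (nseq j k) y) = pm1 (elemM y * elemM k ^+ j * elemM x).
Proof.
rewrite /solution /= /Mprod rev_cons rev_rcons rev_nseq rcons_cons big_cons.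
by rewrite -cats1 big_cat big_seq1 -[nseq j k]rev_nseq mulrA -Mprod_nseq.
Qed.

Lemma tuple_equiv_nseq s c : tuple_equiv (nseq s k) c <-> c = nseq s k.
Proof.
have rotE i : rot i (nseq s k) = nseq s k.
  have /all_pred1P : all (pred1 k) (rot i (nseq s k)).
    by rewrite /rot all_cat andbC -all_cat cat_take_drop all_pred1_nseq.
  by rewrite size_rot size_nseq.
split=> [[i]|->]; last by exists 0%N; left; rewrite rot0.
by rewrite rev_nseq rotE; case.
Qed.

Lemma reducible_nseq s :
  solution (nseq s k) ->
  reducible (nseq s k) <->
  exists j, [/\ (0 < j)%N, (j + 3 <= s)%N & pm1 (chebU k j.+1)].
Proof.
move=> sol; split.
  case=> _ _ [a [b [sa sb solb /tuple_equiv_nseq]]].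
  case: a sa => [|a1 [|a2 [|a3 a]]] // _.
  case: b sb solb => [|b1 [|b2 [|b3 b]]] // _ solb /esym/= E.
  have : all (pred1 k) (belast b2 (b3 :: b)).
    have : all (pred1 k) (nseq s k) by rewrite all_pred1_nseq.
    by rewrite E /= all_cat /= => /and5P[_ _ _ _ ->].
  move/all_pred1P; rewrite size_belast => bE.
  have sE : s = (size a + size b).+4.
    rewrite -(size_nseq s k) E /= size_cat /= !size_belast; lia.
  exists (size b).+1; split=> //; first lia.
  move: solb; rewrite [b2 :: _]lastI bE solution_sandwich pm1_elemM_sandwich.
  by case/and3P.
case=> j [j_gt0 js Uj]; split=> //; first by rewrite size_nseq; lia.
(* [pm1_elemM_sandwich] forces these ends on the second summand; the ends k - x of the first one
   restore the entry k where the two are glued. *)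
pose x := chebU k j.+1 * chebU k j.
exists ((k - x) :: rcons (nseq (s - j - 2) k) (k - x)).
exists (x :: rcons (nseq j k) x); split.
- by rewrite /= size_rcons size_nseq; lia.
- by rewrite /= size_rcons size_nseq; lia.
- by rewrite solution_sandwich pm1_elemM_sandwich Uj !eqxx.
apply/tuple_equiv_nseq.
have [t sE] : exists t, s = (j + t + 3)%N by exists (s - j - 3)%N; lia.
have -> : (s - j - 2 = t.+1)%N by lia.
case: j j_gt0 js Uj x sE => // j _ js Uj x sE /=.
rewrite !last_rcons !belast_rcons !subrK.
have -> : s = (t.+1 + j.+2).+1%N by lia.
by rewrite [RHS]/= nseqD.
Qed.

Lemma pm1_monomial_size : pm1 (elemM k ^+ monomial_size k).
Proof.
rewrite /monomial_size; case: ex_minnP => s.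
by rewrite solution_nseq => /andP[].
Qed.

Lemma monomial_size_gt0 : (0 < monomial_size k)%N.
Proof.
rewrite /monomial_size; case: ex_minnP => s.
by rewrite solution_nseq => /andP[].
Qed.

Lemma monomial_size_min j :
  (0 < j)%N -> pm1 (elemM k ^+ j) -> (monomial_size k <= j)%N.
Proof.
rewrite /monomial_size; case: ex_minnP => s _ min_s j_gt0 Ej.
by apply: min_s; rewrite solution_nseq j_gt0.
Qed.

Lemma monomial_minimal_solutionP : solution (monomial_minimal_solution k).
Proof. by rewrite solution_nseq monomial_size_gt0 pm1_monomial_size. Qed.

(* Excluding E^j and E^(j+2) excludes j = 0 and j = -2 modulo the size s, so  *)
(* that j may be any natural number instead of one in [1, s - 3].             *)
Lemma reducible_monomialP :
  reducible (monomial_minimal_solution k) <->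
  exists j, [/\ pm1 (chebU k j.+1), ~~ pm1 (elemM k ^+ j)
             & ~~ pm1 (elemM k ^+ (j + 2))].
Proof.
set s := monomial_size k.
split=> [/(reducible_nseq monomial_minimal_solutionP)|].
  rewrite -/s => -[j [j_gt0 js Uj]]; exists j; split=> //.
    by apply/negP=> /(monomial_size_min j_gt0); rewrite -/s; lia.
  by apply/negP=> /monomial_size_min; rewrite -/s; lia.
case=> j [Uj Ej Ej2]; apply/(reducible_nseq monomial_minimal_solutionP).
rewrite -/s; pose r := (j %% s)%N; exists r.
have Es := pm1_monomial_size; rewrite -/s in Es.
have Emod i : pm1 (elemM k ^+ (j + i)) = pm1 (elemM k ^+ (r + i)).
  rewrite {1}(divn_eq j s) -addnA exprD mulnC exprM.
  by rewrite pm1_mull // pm1X.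
have Ur : pm1 (chebU k r.+1).
  move: Uj; rewrite -2!elemM_exp00 {1}(divn_eq j s) exprD mulnC exprM -/r.
  have /pm1P[->|->] := pm1X (j %/ s) Es; first by rewrite mul1r.
  by rewrite mulN1r mxE pm1N.
have := Emod 0%N; rewrite !addn0 => Er; rewrite Er in Ej.
rewrite Emod in Ej2.
have r_gt0 : (0 < r)%N.
  by rewrite lt0n; apply: contraNneq Ej => ->; rewrite expr0 /pm1 eqxx.
have r_lt : (r < s)%N by rewrite ltn_mod monomial_size_gt0.
split=> //; have [|lt2] := leqP (r + 3) s; first by [].
have : (r + 2)%N = s \/ r.+1 = s by lia.
case=> rs; first by rewrite rs Es in Ej2.
(* Here r + 1 = s, so U_(r+1) would be both 0 and a sign. *)
move: Es; rewrite pm1_elemM_exp -rs => /andP[/eqP U0 _].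
by move: Ur => /pm1_unit; rewrite U0 unitr0.
Qed.
End MonomialSolutions.

Lemma monomial_minimal_solution_inj N :
  injective (@monomial_minimal_solution N).
Proof.
move=> x y E; have := monomial_size_gt0 x; move: E.
rewrite /monomial_minimal_solution.
by case: (monomial_size x) => // i; case: (monomial_size y) => // j [->].
Qed.

Lemma irreducible_monomialP N (k : 'Z_N) : k != 0 ->
  irreducible_solution (monomial_minimal_solution k) <->
  forall j, pm1 (chebU k j.+1) ->
    pm1 (elemM k ^+ j) \/ pm1 (elemM k ^+ (j + 2)).
Proof.
move=> k0; split=> [[_ _ nred] j Uj|irr].
  apply/orP; apply/negP => /negP; rewrite negb_or => /andP[Ej Ej2].
  by apply: nred; apply/reducible_monomialP; exists j.
split; first exact: monomial_minimal_solutionP.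
  rewrite /monomial_minimal_solution; case: monomial_size => // s [/eqP].
  by rewrite (negPf k0).
by case/reducible_monomialP=> j [/irr[] ->].
Qed.

Lemma not_irreducible_0 N :
  ~ irreducible_solution (monomial_minimal_solution (0 : 'Z_N)).
Proof.
case=> _ + _; apply; rewrite /monomial_minimal_solution.
suff -> : monomial_size (0 : 'Z_N) = 2%N by [].
have /(monomial_size_min (isT : 0 < 2)%N) : pm1 (elemM (0 : 'Z_N) ^+ 2).
  by rewrite pm1_elemM_exp /= !mul0r subr0 sub0r eqxx /pm1 eqxx orbT.
have := pm1_monomial_size (0 : 'Z_N); have := monomial_size_gt0 (0 : 'Z_N).
case: monomial_size => [|[|[|s]]] // _.
rewrite pm1_elemM_exp => /andP[/eqP U1 _].
by have /eqP[] := oner_neq0 'Z_N; apply: U1.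
Qed.

(** * Prime powers of elements close to 1 *)

Lemma exprD1_prime (A : pzRingType) (p : nat) (y : A) : prime p ->
  exists z, (1 + y) ^+ p = 1 + y *+ p + (y ^+ 2 * z) *+ p + y ^+ p.
Proof.
move=> pP; have [q pE] : exists q, p = q.+2.
  by exists p.-2; have := prime_gt1 pP; lia.
have sumE (F : nat -> A) : \sum_(i < p.+1) F i =
    F 0%N + F 1%N + \sum_(i < q) F i.+2 + F p.
  by rewrite pE big_ord_recr /= 2!big_ord_recl /= addrA.
(* Only the middle binomial coefficients are divisible by p, so the last term stays apart. *)
exists (\sum_(i < q) y ^+ i *+ ('C(p, i.+2) %/ p)).
rewrite exprDn_comm; last exact: commr_sym (commr1 y).
rewrite (sumE (fun i => 1 ^+ (p - i) * y ^+ i *+ 'C(p, i))).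
rewrite !expr1n !mul1r expr0 expr1 bin0 bin1 binn mulr_sumr -sumrMnl.
congr (_ + _ + _); apply: eq_bigr => i _.
rewrite expr1n mul1r mulrnAr -exprD -mulrnA divnK //.
by rewrite prime_dvd_bin // pE; have := ltn_ord i; lia.
Qed.

(* The second hypothesis makes the last binomial term [c ^+ p] as small as    *)
(* the middle ones: it is automatic for odd [p], and says [4 %| k] for        *)
(* [p = 2].                                                                   *)
Lemma exprB1_prime_power (R : comNzRingType) (A : algType R) (p i : nat)
    (k l u : R) (x : A) :
  prime p -> k = p%:R * l -> k ^+ p.-1 = p%:R ^+ 2 * u ->
  exists z, (1 - k *: x) ^+ (p ^ i) = 1 - (p%:R ^+ i * k) *: (x + p%:R *: z).
Proof.
move=> pP kE kpE; elim: i => [|i [z IH]].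
  by exists 0; rewrite expr0 mul1r scaler0 addr0 expr1.
rewrite expnSr exprM IH; set W := x + _; set c := _ * k.
have [w ->] := exprD1_prime (- (c *: W)) pP.
pose v := (p%:R ^+ i) ^+ p.-1 * u.
(* Both error terms of the expansion are multiples of p times the new coefficient pc, so they can be
   absorbed into the new z. *)
have c2E : c ^+ 2 * p%:R = p%:R * c * p%:R * (p%:R ^+ i * l).
  by rewrite /c kE; ring.
have cpE : c ^+ p = p%:R * c * p%:R * v.
  by rewrite -[in LHS](prednK (prime_gt0 pP)) exprS {2}/c exprMn kpE /v; ring.
pose s := (p%:R ^+ i * l) *: (W ^+ 2 * w).
pose t := (-1) ^+ p * (v *: W ^+ p).
exists (z - s - t).
have -> : p%:R ^+ i.+1 * k = p%:R * c by rewrite exprS -mulrA.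
have -> : x + p%:R *: (z - s - t) = W - p%:R *: s - p%:R *: t.
  by rewrite !scalerBr !addrA.
rewrite sqrrN exprNn !exprZn mulNrn -!scaler_nat -scalerAl !scalerA.
rewrite cpE (mulrC p%:R (c ^+ 2)) c2E -!(scalerA (_ * p%:R)) -scalerAr.
rewrite -/s -/t !scalerBr !scalerA !opprB !mulrA -!addrA.
by congr (1 + _); rewrite addrC [in LHS](addrC (_ *: (_ * w))) -addrA.
Qed.

(** * Units and multiples of p modulo a prime power *)

Section PrimePowerModulus.
Variables (p n : nat).
Hypotheses (pP : prime p) (n_gt0 : (0 < n)%N).
Local Notation R := 'Z_(p ^ n).
Implicit Types (x y k : R).

Lemma ltn1_prime_power : (1 < p ^ n)%N.
Proof. by rewrite -(exp1n n) ltn_exp2r ?prime_gt1. Qed.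

Lemma unit_natr_Zpn m : ((m%:R : R) \is a GRing.unit) = ~~ (p %| m)%N.
Proof.
by rewrite unitZpE ?ltn1_prime_power // coprime_pexpl // prime_coprime.
Qed.

Lemma natr_Zpn_eq0 m : ((m%:R : R) == 0) = (p ^ n %| m)%N.
Proof. by rewrite -val_eqE /= val_Zp_nat ?ltn1_prime_power. Qed.

Lemma unit_intr_Zpn (m : int) :
  ((m%:~R : R) \is a GRing.unit) = ~~ (p%:Z %| m)%Z.
Proof.
rewrite dvdzE /=; case: m => m; first exact: unit_natr_Zpn.
by rewrite NegzE rmorphN unitrN abszN; exact: unit_natr_Zpn.
Qed.

Lemma nunit_mulp y : (p%:R * y) \isn't a GRing.unit.
Proof. by rewrite unitrM unit_natr_Zpn dvdnn. Qed.

(** The ring is local with maximal ideal generated by p. *)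
Lemma unit_or_mulp x : x \is a GRing.unit \/ exists y, x = p%:R * y.
Proof.
rewrite -[x]natr_Zp unit_natr_Zpn; case: dvdnP => [[q ->]|]; last by left.
by right; exists q%:R; rewrite mulnC natrM.
Qed.

Lemma unitD_mulp x y : x \is a GRing.unit -> x + p%:R * y \is a GRing.unit.
Proof.
move=> Ux; have [//|[z xyE]] := unit_or_mulp (x + p%:R * y).
have := nunit_mulp (z - y); suff -> : p%:R * (z - y) = x by rewrite Ux.
by rewrite mulrBr -xyE addrK.
Qed.

Lemma expp_Zpn : (p%:R : R) ^+ n = 0.
Proof. by rewrite -natrX pchar_Zp ?ltn1_prime_power. Qed.

Lemma irreducible_unit k : k \is a GRing.unit ->
  irreducible_solution (monomial_minimal_solution k).
Proof.
move=> Uk; apply/irreducible_monomialP => [|j Uj].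
  by apply: contraTneq Uk => ->; rewrite unitr0.
have prod0 : chebU k j * chebU k j.+2 = 0.
  have := chebU_cassini k j; rewrite -[in RHS](pm1_sqr Uj) expr2.
  by move/eqP; rewrite -subr_eq0 addrAC subrr sub0r oppr_eq0 => /eqP.
have sumE : chebU k j + chebU k j.+2 = k * chebU k j.+1.
  by rewrite chebUSS; ring.
have [U0|[a aE]] := unit_or_mulp (chebU k j).
  right; rewrite addn2 pm1_elemM_exp; move/(canRL (mulKr U0)): prod0.
  by rewrite mulr0 (chebUSS _ j.+1) => ->; rewrite eqxx mulr0 sub0r pm1N.
have [U2|[b bE]] := unit_or_mulp (chebU k j.+2).
  left; rewrite pm1_elemM_exp Uj; move/(canRL (mulrK U2)): prod0.
  by rewrite mul0r => ->; rewrite eqxx.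
have : k * chebU k j.+1 \is a GRing.unit by rewrite unitrM Uk pm1_unit.
by rewrite -sumE aE bE -mulrDr (negPf (nunit_mulp _)).
Qed.

Lemma not_irreducible_mulp k (l u : R) :
  k = p%:R * l -> k ^+ p.-1 = p%:R ^+ 2 * u -> 2 * k != 0 ->
  ~ irreducible_solution (monomial_minimal_solution k).
Proof.
move=> kE kpE k2 [_ _]; apply; apply/reducible_monomialP.
have k0 : k != 0 by apply: contraNneq k2 => ->; rewrite mulr0.
have ex_t : exists t, p%:R ^+ t * k == 0 by exists n; rewrite expp_Zpn mul0r.
case: (ex_minnP ex_t) => -[|t]; first by rewrite mul1r (negPf k0).
(* As t + 1 is the least exponent killing k, d is nonzero but pd = 0; this removes the unknown pz
   from E^(2m), and dk = 0 makes U_(2m+1) a sign. *)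
set d := p%:R ^+ t * k => /eqP pd0 t_min.
have d0 : d != 0 by apply/negP=> /t_min; rewrite ltnn.
have {}pd0 : d * p%:R = 0 by rewrite -pd0 exprS /d; ring.
have dk0 : d * k = 0 by rewrite kE mulrA pd0 mul0r.
pose m := (p ^ t)%N; pose e : R := (-1) ^+ m.
have e_pm1 : pm1 e by apply: pm1X; rewrite /pm1 eqxx orbT.
have E2 : elemM k ^+ 2 = - (1 - k *: elemM k).
  have c2 : chebU k 2 = k by rewrite /=; ring.
  have c3 : chebU k 3 - k * k = -1 by rewrite chebUSS c2 /=; ring.
  by rewrite elemM_expE c2 c3 opprB raddfN.
have EE : elemM k ^+ (2 * m) = e *: (1 - d *: elemM k).
  have [z zE] := exprB1_prime_power t (elemM k) pP kE kpE.
  rewrite exprM E2 exprNn zE -/d scalerDr scalerA pd0 scale0r addr0.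
  by rewrite /e -scaleN1r exprZn expr1n -scalerAl mul1r.
have U1 : chebU k (2 * m).+1 = e.
  by rewrite -elemM_exp00 EE !mxE /= dk0 subr0 mulr1.
have U0 : chebU k (2 * m) = - (e * d).
  by rewrite -elemM_exp10 EE !mxE /=; ring.
exists (2 * m)%N; rewrite U1 !pm1_elemM_exp; split=> //.
  by rewrite U0 oppr_eq0 mulrI_eq0 ?(negPf d0) //; exact/mulrI/pm1_unit.
rewrite addn2 chebUSS U1 U0.
(* U_(2m+2) is nonzero: the factor 1 + p^t is a unit for t > 0, and t = 0 gives 2k, nonzero by
   hypothesis. *)
have -> : k * e - - (e * d) = e * ((1 + p%:R ^+ t) * k) by rewrite /d; ring.
rewrite mulrI_eq0; last exact/mulrI/pm1_unit.
have [->|t_gt0] := posnP t; first by rewrite expr0 (negPf k2).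
rewrite -(prednK t_gt0) exprS mulrI_eq0 ?(negPf k0) //.
exact/mulrI/unitD_mulp/unitr1.
Qed.

End PrimePowerModulus.

(** * Counting residues, and the criterion for odd p *)

Lemma has_exactly_monomial (N : nat) (Q : pred 'Z_N) :
  (forall k, irreducible_solution (monomial_minimal_solution k) <-> Q k) ->
  has_exactly #|Q| (fun c : seq 'Z_N =>
    is_monomial_minimal c /\ irreducible_solution c).
Proof.
move=> irrQ; exists [seq monomial_minimal_solution k | k <- enum Q]; split.
- by rewrite (map_inj_uniq (@monomial_minimal_solution_inj N)) enum_uniq.
- move=> c; split=> [/mapP[k + ->]|[[k ->] /irrQ Qk]].
    by rewrite mem_enum => /irrQ; split=> //; exists k.
  by apply: map_f; rewrite mem_enum.
by rewrite size_map -cardE.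
Qed.

Lemma card_Zp_pred (N : nat) (q : pred nat) : (1 < N)%N ->
  #|[pred x : 'Z_N | q x]| = (\sum_(0 <= i < N) q i)%N.
Proof.
move=> N_gt1; rewrite -sum1_card big_mkcond /=.
rewrite -[in RHS](Zp_cast N_gt1) big_mkord.
by apply: eq_bigr => x _; rewrite inE; case: (q x).
Qed.

Lemma sum_ndvdn4 q : (\sum_(0 <= i < 4 * q) ~~ (4 %| i) = 3 * q)%N.
Proof.
elim: q => [|q IH]; first by rewrite big_nil.
rewrite mulnS addnC !addnS addn0 !big_nat_recr //= IH.
have [-> -> -> ->] : [/\ 4 %| 4 * q, ~~ (4 %| (4 * q).+1),
  ~~ (4 %| (4 * q).+2) & ~~ (4 %| (4 * q).+3)]%N by split; lia.
by rewrite mulnS /=; lia.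
Qed.

Lemma irreducible_odd (p n : nat) (k : 'Z_(p ^ n)) :
  prime p -> (0 < n)%N -> p <> 2%N ->
  irreducible_solution (monomial_minimal_solution k) <-> k \is a GRing.unit.
Proof.
move=> pP n_gt0 p2; split=> [|Uk]; last exact: irreducible_unit.
have [//|[l kE]] := unit_or_mulp pP n_gt0 k.
have [->|k0] := eqVneq k 0; first by move/not_irreducible_0.
have p_gt2 : (2 < p)%N by have := prime_gt1 pP; lia.
have kpE : k ^+ p.-1 = p%:R ^+ 2 * (p%:R ^+ (p - 3) * l ^+ p.-1).
  by rewrite kE exprMn mulrA -exprD; congr (_ ^+ _ * _); lia.
case/(not_irreducible_mulp pP n_gt0 kE kpE).
rewrite mulrI_eq0 //; apply/mulrI; rewrite unit_natr_Zpn //.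
by rewrite dvdn_prime2 //; apply/eqP.
Qed.

(** * Modulus a power of 2 *)

Section PowerOfTwoModulus.
Variable n : nat.
Hypothesis n_gt0 : (0 < n)%N.
Local Notation R := 'Z_(2 ^ n).
Implicit Types (k a x y : R).
Let P2 : prime 2 := isT.

Lemma unit2_odd x : x \is a GRing.unit -> exists y, x = 1 + 2 * y.
Proof.
rewrite -[x]natr_Zp unit_natr_Zpn // dvdn2 negbK => odd_x.
exists (x./2)%:R; rewrite -[in LHS](odd_double_half x) odd_x.
by rewrite natrD -muln2 natrM mulrC.
Qed.

Lemma two_expn_pred : (2%:R : R) ^+ n.-1 * 2 = 0.
Proof. by rewrite mulrC -exprS prednK // expp_Zpn. Qed.

Lemma double_eq0 k : 2 * k = 0 -> k = 0 \/ k = 2%:R ^+ n.-1.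
Proof.
rewrite -[k]natr_Zp -natrM; set m := nat_of_ord k.
move/eqP; rewrite natr_Zpn_eq0 // -[in X in (X %| _)%N](prednK n_gt0) expnS.
rewrite dvdn_pmul2l //.
case/dvdnP=> q ->; rewrite natrM natrX -(odd_double_half q) natrD -muln2 natrM.
rewrite mulrDl -mulrA [2%:R * _]mulrC two_expn_pred mulr0 addr0.
by case: odd; rewrite ?mul1r ?mul0r; auto.
Qed.

(** For even k the terms of even index are multiples of 2, hence not units. *)
Lemma pm1_chebU_even k a j :
  k = 2 * a -> pm1 (chebU k j.+1) -> exists m, j = m.*2.
Proof.
move=> kE; have := odd_double_half j; case: odd => [|<- _]; last by exists j./2.
rewrite add1n => <- /pm1_unit; rewrite -doubleS chebU_even kE.
by rewrite -mulrA -mulrBr mulrCA (negPf (nunit_mulp _ _ _)).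
Qed.

Lemma irreducible_double_unit a : a \is a GRing.unit -> 2 * a != 0 ->
  irreducible_solution (monomial_minimal_solution (2 * a)).
Proof.
move=> Ua k0; apply/irreducible_monomialP => // j; set k := 2 * a => Uj.
have [m jE] := pm1_chebU_even (erefl k) Uj; rewrite jE in Uj *.
pose T i := chebU k i.+1 - a * chebU k i.
have TE i : 2 * chebU k i.+1 - k * chebU k i = 2 * T i.
  by rewrite /T /k; ring.
have UT i : T i \is a GRing.unit.
  have [b aE] := unit2_odd Ua.
  (* By [chebU_det] the square is 1 + (a^2 - 1) U_i^2, and a is odd. *)
  have TT : T i * T i = 1 + 2 * (2 * b * (1 + b) * chebU k i ^+ 2).
    by rewrite -{1}(chebU_det k i) /T /k aE; ring.
  have : T i * T i \is a GRing.unit by rewrite TT unitD_mulp ?unitr1.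
  by rewrite unitrM => /andP[].
have cancelT i y : y * (2 * T i) = 0 -> y * 2 = 0.
  by rewrite mulrA => /(canRL (mulrK (UT i))); rewrite mul0r.
case/pm1P: (Uj) => U1; [left | right].
  have := chebU_oddB1 k m; rewrite U1 subrr TE => /esym/cancelT U2.
  by rewrite pm1_elemM_exp Uj chebU_even TE mulrA U2 mul0r eqxx.
have := chebU_oddD1 k m; rewrite U1 addNr TE => /esym/cancelT U2.
have U0 : chebU k m.*2.+2 = 0 by rewrite -doubleS chebU_even TE mulrA U2 mul0r.
by rewrite addn2 pm1_elemM_exp (chebUSS _ m.*2.+1) U0 eqxx mulr0 sub0r pm1N.
Qed.

(** Since 2k = k^2 = 0, E^4 is the identity; j is even, so j or j + 2 is a multiple of 4. *)
Lemma irreducible_half_modulus : (1 < n)%N ->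
  irreducible_solution (monomial_minimal_solution (2%:R ^+ n.-1 : R)).
Proof.
move=> n_gt1; set k := _ ^+ _.
have k0 : k != 0.
  rewrite /k -natrX natr_Zpn_eq0 // gtnNdvd ?expn_gt0 // ltn_exp2l //; lia.
have kE : k = 2 * 2%:R ^+ n.-2 by rewrite -exprS; congr (_ ^+ _); lia.
have k2 : k * 2 = 0 by exact: two_expn_pred.
have kk : k * k = 0 by rewrite {2}kE mulrA k2 mul0r.
apply/irreducible_monomialP => // j Uj.
have [m ->] := pm1_chebU_even kE Uj.
have E4 : pm1 (elemM k ^+ 4).
  have U2 : chebU k 2 = k by rewrite /=; ring.
  have U3 : chebU k 3 = -1 by rewrite chebUSS U2 kk sub0r.
  have U4 : chebU k 4 = 0.
    by rewrite chebUSS U3 U2 mulrN1 -opprD -mulr2n -mulr_natr k2 oppr0.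
  by rewrite pm1_elemM_exp (chebUSS _ 3) U4 U3 eqxx mulr0 sub0r opprK /pm1 eqxx.
rewrite -(odd_double_half m); case: odd; [right|left].
  have -> : ((1 + m./2.*2).*2 + 2 = 4 * m./2.+1)%N by lia.
  by rewrite exprM pm1X.
have -> : ((0 + m./2.*2).*2 = 4 * m./2)%N by lia.
by rewrite exprM pm1X.
Qed.

Lemma irreducible_mul4 k y : k = 4 * y ->
  irreducible_solution (monomial_minimal_solution k) -> k = 2%:R ^+ n.-1.
Proof.
move=> kE irr; have [k2|k2] := eqVneq (2 * k) 0.
  by case/double_eq0: k2 irr => // -> /not_irreducible_0.
have k2E : k = 2 * (2 * y) by rewrite kE; ring.
have kpE : k ^+ 2.-1 = 2 ^+ 2 * y by rewrite kE /=; ring.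
by case: (not_irreducible_mulp P2 n_gt0 k2E kpE k2).
Qed.

Lemma irreducible_two (k : int) :
  irreducible_solution (monomial_minimal_solution (k%:~R : R)) <->
  [\/ ~ (2 %| k)%Z, (k%:~R : R) = (2 ^ (n - 1))%N%:R
    | (2 <= n)%N /\ exists a : int, ~ (2 %| a)%Z /\ k = 2 * a].
Proof.
rewrite natrX subn1; split.
  move=> irr; case: (boolP (2 %| k)%Z) => [|/negP]; last by constructor 1.
  case/dvdzP=> a kE; have [n2|n2] := leqP 2 n; last first.
    (* For n = 1 an even k is 0 modulo 2. *)
    suff k0 : (k%:~R : R) = 0 by rewrite k0 in irr; case: (not_irreducible_0 irr).
    have := two_expn_pred; have -> : n.-1 = 0%N by lia.
    rewrite expr0 mul1r => two0.
    by rewrite kE rmorphM /= -[2%:~R]/(2%:R : R) two0 mulr0.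
  case: (boolP (2 %| a)%Z) => [|/negP aodd]; last first.
    by constructor 3; split=> //; exists a; rewrite mulrC.
  case/dvdzP=> b aE; constructor 2.
  apply: (@irreducible_mul4 _ b%:~R) => //.
  by rewrite kE aE !rmorphM /=; ring.
case=> [/negP k_odd | -> | [n2 [a [/negP a_odd ->]]]].
- by apply: irreducible_unit => //; rewrite unit_intr_Zpn.
- have [n2|n2] := ltnP 1 n; first exact: irreducible_half_modulus.
  have -> : n.-1 = 0%N by lia.
  by rewrite expr0; apply: irreducible_unit; rewrite ?unitr1.
have Ua : (a%:~R : R) \is a GRing.unit by rewrite unit_intr_Zpn.
rewrite rmorphM /=; apply: irreducible_double_unit => //.
have two0 : (2%:R : R) != 0.
  by rewrite natr_Zpn_eq0 // gtnNdvd // -{1}(expn1 2) ltn_exp2l.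
by apply: contraNneq two0 => /(canRL (mulrK Ua)) ->; rewrite mul0r.
Qed.

(** Odd and twice odd together mean not divisible by 4, which makes the criterion countable. *)
Lemma irreducible_two_nat (x : R) : (1 < n)%N ->
  irreducible_solution (monomial_minimal_solution x) <->
  ~~ (4 %| x)%N || (x == 2%:R ^+ n.-1).
Proof.
move=> n_gt1; set m := nat_of_ord x.
have xE : x = (m%:Z)%:~R by rewrite -[x]natr_Zp.
rewrite {1}xE irreducible_two -xE natrX subn1; split.
  case=> [/negP m_odd | -> | [_ [a [/negP a_odd mE]]]].
  - by apply/orP; left; move: m_odd; rewrite dvdzE /=; lia.
  - by rewrite eqxx orbT.
  - by apply/orP; left; lia.
case/orP=> [m4|/eqP]; last by constructor 2.
case: (boolP (2 %| m)%N) => [/dvdnP[a mE]|m_odd].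
  constructor 3; split=> //; exists a%:Z; split; last by rewrite mE; lia.
  by apply/negP; rewrite dvdzE /=; lia.
by constructor 1; apply/negP; rewrite dvdzE.
Qed.

(** For n >= 3 the residue 2^(n-1) is itself divisible by 4, so it adds exactly one to the residues
    not divisible by 4. *)
Lemma card_irreducible_two : (3 <= n)%N ->
  #|[pred x : R | ~~ (4 %| x)%N || (x == 2%:R ^+ n.-1)]| =
    (3 * 2 ^ (n - 2) + 1)%N.
Proof.
move=> n_ge3; set h : R := _ ^+ _.
have N_gt1 : (1 < 2 ^ n)%N by exact: ltn1_prime_power.
have nE : (2 ^ n = 4 * 2 ^ (n - 2))%N.
  by rewrite -[4%N]/(2 ^ 2)%N -expnD; congr (_ ^ _)%N; lia.
have h4 : (4 %| h)%N.
  rewrite /h -natrX val_Zp_nat // modn_small; last by rewrite ltn_exp2l //; lia.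
  by rewrite -[4%N]/(2 ^ 2)%N dvdn_exp2l //; lia.
rewrite (cardD1 h) inE eqxx orbT addnC; congr (_ + _)%N.
rewrite -sum_ndvdn4 -nE -card_Zp_pred //; apply: eq_card => x; rewrite !inE.
by case: eqVneq => [->|_]; rewrite ?h4 ?orbF.
Qed.

End PowerOfTwoModulus.

Theorem mainTheorem1 (p n : nat) (pP : prime p) (n_ge1 : (1 <= n)%N) :
  (p <> 2%N ->
     (forall k : int,
        irreducible_solution
          (monomial_minimal_solution (k%:~R : 'Z_(p ^ n)))
        <-> ~ (p%:Z %| k)%Z)
     /\ has_exactly (totient (p ^ n))
          (fun c : seq 'Z_(p ^ n) =>
             is_monomial_minimal c /\ irreducible_solution c)
     /\ totient (p ^ n) = (p ^ (n - 1) * (p - 1))%N)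
  /\
  (p = 2%N ->
     (forall k : int,
        irreducible_solution
          (monomial_minimal_solution (k%:~R : 'Z_(p ^ n)))
        <-> [\/ ~ (2 %| k)%Z,
                (k%:~R : 'Z_(p ^ n)) = (2 ^ (n - 1))%N%:R
              | (2 <= n)%N /\ exists a : int, ~ (2 %| a)%Z /\ k = 2 * a])
     /\ ((3 <= n)%N ->
         has_exactly (3 * 2 ^ (n - 2) + 1)%N
           (fun c : seq 'Z_(p ^ n) =>
              is_monomial_minimal c /\ irreducible_solution c))).
Proof.
split=> [p2|->]; last first.
  split=> [k|n_ge3]; first exact: irreducible_two.
  rewrite -card_irreducible_two //; apply: has_exactly_monomial => x.
  by apply: irreducible_two_nat => //; apply: ltn_trans n_ge3.
split=> [k|].
  rewrite irreducible_odd // unit_intr_Zpn //.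
  by split=> /negP.
split; last by rewrite totient_pfactor // mulnC !subn1.
have <- : #|[pred x : 'Z_(p ^ n) | coprime (p ^ n) x]| = totient (p ^ n).
  by rewrite card_Zp_pred ?ltn1_prime_power // totient_count_coprime.
apply: has_exactly_monomial => x.
by rewrite irreducible_odd //= -{1}[x]natr_Zp unitZpE ?ltn1_prime_power.
Qed.
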